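(* If the weak confidence intervals are jointly valid, i.e. on the event $\mathcal{E}=\bigcap_{x\in D}\{v(x)\in[L(x),U(x)]\}$, then the algorithm STC (described in the context) returns the exact top-$k$ set $T_k^\star$. Moreover, it issues at most $m(4\varepsilon_{\max})$ strong oracle calls on $\mathcal{E}$ (and hence in expectation up to the failure event of probability at most $\delta$), where $\varepsilon_{\max}=\max_{x\in D}\tfrac12(U(x)-L(x))$ is the maximum radius of the weak confidence intervals.
   Context: Setting. $D=\{x_1,\dots,x_n\}$ is a set of items with an unknown valuation $v:D\to[0,1]$, and $1\le k\le n$. Items are totally ordered by $v$ (ties broken deterministically by a fixed index order). $T_k^\star\subseteq D$ is the set of the $k$ items with largest $v$. $t^\star=v_{(k)}$ is the $k$-th largest value. For $\eta\ge0$ the near-tie mass is $m(\eta)=|\{x\in D:|v(x)-t^\star|\le\eta\}|$. Oracles. A query to the weak oracle $\mathsf W$ on $x$ returns a random value in $[0,1]$ with mean $v(x)$ and bounded variance; repeated queries are i.i.d. A query to the strong oracle $\mathsf S$ on $x$ returns $v(x)$ exactly. Weak intervals. After $N$ weak queries per item, each item has an interval $[L(x),U(x)]=[\hat v(x)-r_N(x),\hat v(x)+r_N(x)]$, where $\hat v(x)$ is the sample mean and $r_N(x)$ is a valid $(1-\delta_x)$-confidence half-width with $\sum_x\delta_x\le\delta$. Hence $\mathbb P(\mathcal E)\ge 1-\delta$. $L_{(k)}$ and $U_{(k)}$ are the $k$-th largest values (with multiplicity) among $\{L(x):x\in D\}$ and $\{U(x):x\in D\}$. The radius $\varepsilon_{\max}$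 refers to these weak intervals. Algorithm STC (screen-then-certify), with input $D,k,\delta,N$: 1. Build the weak intervals $[L(x),U(x)]$ for all $x$ from $N$ weak queries per item, with joint coverage $1-\delta$. 2. Compute $L_{(k)}$ and $U_{(k)}$. 3. Set $IN=\{x:L(x)>U_{(k)}\}$, $OUT=\{x:U(x)<L_{(k)}\}$, $A=D\setminus(IN\cup OUT)$. 4. For every $x\in A$, query $\mathsf S(x)$ and set $L(x)=U(x)=\mathsf S(x)$. 5. Output $\widehat T_k=IN\cup\mathrm{top}_{k-|IN|}(A)$, where $\mathrm{top}_r(A)$ denotes the $r$ items of $A$ with largest value (in the total order by $v$). *)

(* Defs.v *)
From HB Require Import structures.
From mathcomp Require Import all_boot all_order all_algebra.
From mathcomp Require Import all_classical all_reals all_analysis.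

Set Implicit Arguments.
Unset Strict Implicit.
Unset Printing Implicit Defensive.
Import Order.TTheory GRing.Theory Num.Theory.
Import numFieldNormedType.Exports.

Local Open Scope ring_scope.

(* Items are the indices 'I_n; classical_set_scope is not opened, so
   [set x | P] is a finite set and classical sets carry %classic. *)

Section TopK.
Variables (R : realType) (n : nat).
Implicit Types (f v L U : 'I_n -> R) (A : {set 'I_n}).

(* Decreasing value; among equal values the smaller index comes first. *)
Definition ranked_before f : rel 'I_n :=
  fun x y => (f y < f x) || ((f x == f y) && (x <= y)%N).

Definition top f (r : nat) A : {set 'I_n} :=
  [set x in take r (sort (ranked_before f) (enum A))].

(* k-th largest value, counted with multiplicity; k is 1-based and the default
   0 is only reached when k > n. *)
Definition kth_largest f (k : nat) : R :=
  nth 0 (sort >=%R [seq f x | x <- enum 'I_n]) k.-1.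

Definition near_tie_mass v (k : nat) (eta : R) : nat :=
  #|[set x : 'I_n | `|v x - kth_largest v k| <= eta]|.

(* The unit 0 of the iterated max is harmless when L <= U pointwise and n > 0. *)
Definition max_radius L U : R :=
  \big[Num.max/0]_(x < n) ((U x - L x) / 2).

Record stc_result := StcResult {
  stc_output : {set 'I_n};
  strong_queries : seq 'I_n  (* items sent to the strong oracle, in order *)
}.

(* The final selection only sees the updated values: the strong answer on
   queried items, never the valuation itself. *)
Definition STC (k : nat) (L U strong : 'I_n -> R) : stc_result :=
  let IN := [set x | kth_largest U k < L x] in
  let OUT := [set x | U x < kth_largest L k] in
  let A := ~: (IN :|: OUT) in
  let queries := enum A in
  let L' := fun x => if x \in queries then strong x else L x in
  StcResult (IN :|: top L' (k - #|IN|) A) queries.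

End TopK.

Section WeakOracle.
Context d (T : measurableType d) (R : realType) (P : probability T R).

Definition mutually_independent (X : nat -> {RV P >-> R}) : Prop :=
  forall (s : seq nat) (B : nat -> set R),
    uniq s -> (forall i, measurable (B i)) ->
    P (\bigcap_(i in [set` s]) (X i @^-1` B i))%classic =
    (\prod_(i <- s) P (X i @^-1` B i)%classic)%E.

Definition identically_distributed (X : nat -> {RV P >-> R}) : Prop :=
  forall (i j : nat) (B : set R), measurable B ->
    distribution P (X i) B = distribution P (X j) B.

(* W x i is the answer to the i-th weak query on item x. Independence is only
   required between repeated queries on the same item. *)
Record weak_oracle (n : nat) (v : 'I_n -> R)
    (W : 'I_n -> nat -> {RV P >-> R}) : Prop := WeakOracle {
  weak_range : forall x i w, 0 <= W x i w <= 1;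
  weak_mean : forall x i, 'E_P[W x i]%E = (v x)%:E;
  weak_variance : exists s2 : R, forall x i, ('V_P[W x i] <= s2%:E)%E;
  weak_indep : forall x, mutually_independent (W x);
  weak_ident : forall x, identically_distributed (W x)
}.

Variables (n : nat) (W : 'I_n -> nat -> {RV P >-> R}) (N : nat)
  (r : 'I_n -> {RV P >-> R}).

Definition sample_mean (x : 'I_n) (w : T) : R :=
  (\sum_(i < N) W x i w) / N%:R.

Definition weak_lower (w : T) (x : 'I_n) : R := sample_mean x w - r x w.
Definition weak_upper (w : T) (x : 'I_n) : R := sample_mean x w + r x w.

(* The half-widths are random variables, so that data-dependent radii are
   covered as well as deterministic ones. *)
Definition valid_half_widths (v dlt : 'I_n -> R) : Prop :=
  forall x, (forall w, 0 <= r x w) /\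
    ((1 - dlt x)%:E <=
       P [set w | (`|sample_mean x w - v x| <= r x w)%R]%classic)%E.

Definition coverage_event (v : 'I_n -> R) : set T :=
  (\bigcap_(x in [set: 'I_n])
     [set w | (weak_lower w x <= v x <= weak_upper w x)%R])%classic.

Definition stc_run (k : nat) (strong : 'I_n -> R) (w : T) : stc_result n :=
  STC k (weak_lower w) (weak_upper w) strong.

Definition strong_calls (k : nat) (strong : 'I_n -> R) (w : T) : nat :=
  size (strong_queries (stc_run k strong w)).

Definition eps_max (w : T) : R := max_radius (weak_lower w) (weak_upper w).

End WeakOracle.

(* Main.v *)
Require Import Defs.
From HB Require Import structures.
From mathcomp Require Import all_boot all_order all_algebra.
From mathcomp Require Import all_classical all_reals all_analysis.
From mathcomp Require Import measurable_realfun lra.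
Import Order.TTheory GRing.Theory Num.Theory.
Import numFieldNormedType.Exports.
Local Open Scope ring_scope.

(** At most k - 1 items have U > U_(k), and at least k items have L >= L_(k).
    When L <= v <= U, an item of IN missing from the true top k would have all k
    top items above it, each with U > U_(k); an item of OUT inside the top k
    would be ranked before some item with L >= L_(k). So the rest of the top k
    lies in A, where it is an initial segment for v, hence what the certification
    step selects. The order statistics are 1-Lipschitz in the sup norm and each
    interval has length at most 2 eps, so an item of A satisfies
    |v - t| <= 2 eps + 2 eps, with t the k-th largest value of v. *)

(** * The ranking order and its initial segments *)

Lemma ranked_before_total (R : realType) (n : nat) (f : 'I_n -> R) :
  total (ranked_before f).
Proof.
move=> x y; rewrite /ranked_before.
by case: (ltgtP (f x) (f y)) => //= _; exact: leq_total.
Qed.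

Lemma ranked_before_trans (R : realType) (n : nat) (f : 'I_n -> R) :
  transitive (ranked_before f).
Proof.
move=> y x z; rewrite /ranked_before.
case: (ltgtP (f x) (f y)) => //= [fyx _|->].
  by case: (ltgtP (f y) (f z)) => //= [fzy|<-]; rewrite ?(lt_trans fzy fyx) ?fyx.
by case: (ltgtP (f y) (f z)) => //= _; exact: leq_trans.
Qed.

Lemma ranked_before_anti (R : realType) (n : nat) (f : 'I_n -> R) :
  antisymmetric (ranked_before f).
Proof.
move=> x y; rewrite /ranked_before.
by case: (ltgtP (f x) (f y)) => //= _ /anti_leq /val_inj.
Qed.

Lemma ranked_before_ge (R : realType) (n : nat) (f : 'I_n -> R) (x y : 'I_n) :
  ranked_before f x y -> f y <= f x.
Proof. by case/orP => [/ltW//|/andP[/eqP-> _]]. Qed.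

Lemma top_sub (R : realType) (n : nat) (f : 'I_n -> R) (r : nat)
  (A : {set 'I_n}) : top f r A \subset A.
Proof.
by apply/fintype.subsetP => x; rewrite inE => /mem_take; rewrite mem_sort mem_enum.
Qed.

Lemma card_top (R : realType) (n : nat) (f : 'I_n -> R) (r : nat)
  (A : {set 'I_n}) : (r <= #|A|)%N -> #|top f r A| = r.
Proof.
move=> rA; rewrite cardsE (card_uniqP _); last first.
  by rewrite take_uniq// sort_uniq enum_uniq.
by rewrite size_takel// size_sort -cardE.
Qed.

(** A sorted list is pairwise ordered, so each element of the prefix kept by [take r] precedes each
    element of the dropped suffix. *)
Lemma top_before (R : realType) (n : nat) (f : 'I_n -> R) (r : nat)
    (A : {set 'I_n}) (x y : 'I_n) :
  x \in top f r A -> y \in A -> y \notin top f r A -> ranked_before f x y.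
Proof.
rewrite /top !inE -[y \in A]mem_enum -(mem_sort (ranked_before f) (enum A) y).
set s := sort _ _ => xs ys yNs.
have := sort_sorted (ranked_before_total _ _ f) (enum A); rewrite -/s.
rewrite (sorted_pairwise (ranked_before_trans _ _ f)) -(cat_take_drop r s).
rewrite pairwise_cat => /andP[/allrelP/(_ x y xs) + _]; apply.
by move: ys; rewrite -{1}(cat_take_drop r s) mem_cat (negbTE yNs).
Qed.

(** Breaking ties by index makes [ranked_before] antisymmetric, so a sorted list is determined by
    its elements. Sorting [X] and [A :\: X] separately and concatenating therefore gives the sorted
    list of [A], whose first [#|X|] entries are those of [X]. *)
Lemma top_unique (R : realType) (n : nat) (f : 'I_n -> R)
    (A X : {set 'I_n}) : X \subset A ->
  (forall x y, x \in X -> y \in A -> y \notin X -> ranked_before f x y) ->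
  top f #|X| A = X.
Proof.
move=> XA Xf; rewrite /top.
pose le := ranked_before f.
have -> : sort le (enum A) = sort le (enum X) ++ sort le (enum (A :\: X)).
  apply: (sorted_eq (ranked_before_trans _ _ f) (ranked_before_anti _ _ f)).
  - exact: sort_sorted (ranked_before_total _ _ f) _.
  - have tr := ranked_before_trans _ _ f.
    rewrite (sorted_pairwise tr) pairwise_cat -!(sorted_pairwise tr).
    rewrite !(sort_sorted (ranked_before_total _ _ f)) !andbT.
    apply/allrelP => x y; rewrite !mem_sort !mem_enum inE => xX /andP[yX yA].
    exact: Xf.
  - apply: uniq_perm; rewrite ?sort_uniq ?enum_uniq//.
      rewrite cat_uniq !sort_uniq !enum_uniq andbT /=.
      by apply/hasPn => x; rewrite !mem_sort !mem_enum inE => /andP[].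
    move=> x; rewrite mem_cat !mem_sort !mem_enum !inE.
    by case: (boolP (x \in X)) => [/(fintype.subsetP XA)|].
rewrite take_size_cat; last by rewrite size_sort cardE.
by apply/setP => x; rewrite inE mem_sort mem_enum.
Qed.

(** * Order statistics by counting *)

(** Since [p] is upward closed, the values satisfying it form a prefix of the decreasing list; entry
    [k.-1] lies in that prefix exactly when the prefix has length at least [k]. *)
Lemma kth_largest_count (R : realType) (n : nat) (f : 'I_n -> R) (k : nat)
    (p : pred R) : (0 < k <= n)%N ->
  (forall a b, a <= b -> p a -> p b) ->
  p (kth_largest f k) = (k <= #|[set x | p (f x)]|)%N.
Proof.
move=> /andP[k0 kn] pP; rewrite /kth_largest; set s := sort _ _.
have ss : sorted >=%R s by apply: sort_sorted => x y; exact: le_total.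
have sz : size s = n by rewrite size_sort size_map size_enum_ord.
have -> : #|[set x | p (f x)]| = count p s.
  by rewrite count_sort count_map cardsE cardE size_filter -enumT.
have ge_trans : transitive (>=%R : rel R) by move=> b a c; exact: ge_trans.
have ks : (k.-1 < size s)%N by rewrite sz prednK.
have hnth := sorted_leq_nth ge_trans (fun x => lexx x) 0 ss.
apply/idP/idP => [pk|].
  rewrite -[s](cat_take_drop k) count_cat.
  rewrite -[X in (X <= _)%N](_ : count p (take k s) = k).
    exact: leq_addr.
  apply/eqP; rewrite -[X in _ == X](@size_takel k _ s) ?sz// -all_count.
  apply/(all_nthP 0) => i; rewrite size_takel ?sz// => ik.
  rewrite nth_take//; apply: pP pk; apply: hnth => //.
    by rewrite inE sz (leq_trans ik).
  by rewrite -ltnS prednK.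
(* Contrapositive: if entry [k.-1] fails [p], so do all later ones, and only the first [k.-1]
   entries can be counted. *)
apply: contraTT => pk; rewrite -ltnNge -[s](cat_take_drop k.-1) count_cat.
rewrite [X in (_ + X)%N](_ : _ = 0)%N ?addn0.
  rewrite -[X in (_ < X)%N](prednK k0) ltnS (leq_trans (count_size _ _))//.
  by rewrite size_take_min geq_minl.
apply/eqP; rewrite -leqn0 leqNgt -has_count -all_predC.
apply/(all_nthP 0) => i; rewrite size_drop ltn_subRL => ik /=.
rewrite nth_drop; apply: contra pk; apply: pP; apply: hnth => //.
exact: leq_addr.
Qed.

Lemma le_kth_largest (R : realType) (n : nat) (f : 'I_n -> R) (k : nat)
    (c : R) : (0 < k <= n)%N ->
  (c <= kth_largest f k) = (k <= #|[set x | (c <= f x)%R]|)%N.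
Proof.
move=> kn; apply: (kth_largest_count _ _ f k (fun a => c <= a) kn).
by move=> a b ab /le_trans; exact.
Qed.

Lemma lt_kth_largest (R : realType) (n : nat) (f : 'I_n -> R) (k : nat)
    (c : R) : (0 < k <= n)%N ->
  (c < kth_largest f k) = (k <= #|[set x | (c < f x)%R]|)%N.
Proof.
move=> kn; apply: (kth_largest_count _ _ f k (fun a => c < a) kn).
by move=> a b ab /lt_le_trans; exact.
Qed.

(** At least [k] items have [f] at or above [kth_largest f k]; on each of them [g] is at least that
    value minus [c]. *)
Lemma kth_largest_leD (R : realType) (n : nat) (f g : 'I_n -> R) (k : nat)
    (c : R) : (0 < k <= n)%N -> (forall x, f x <= g x + c) ->
  kth_largest f k <= kth_largest g k + c.
Proof.
move=> kn fg; rewrite -lerBlDr le_kth_largest//.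
have := lexx (kth_largest f k); rewrite le_kth_largest// => /leq_trans; apply.
apply/subset_leq_card/fintype.subsetP => x; rewrite !inE lerBlDr => /le_trans; apply.
exact: fg.
Qed.

(** * The algorithm on fixed intervals containing the values *)

Lemma max_radius_ge (R : realType) (n : nat) (L U : 'I_n -> R) (x : 'I_n) :
  (U x - L x) / 2 <= max_radius L U.
Proof. by rewrite /max_radius le_bigmax. Qed.

Lemma STC_output_top (R : realType) (n k : nat) (v L U strong : 'I_n -> R) :
  (0 < k <= n)%N -> (forall x, strong x = v x) ->
  (forall x, L x <= v x <= U x) ->
  stc_output (STC k L U strong) = top v k [set: 'I_n]%SET.
Proof.
move=> kn strongE LvU; rewrite /STC /=.
set IN := [set x | kth_largest U k < L x]; set OUT := [set x | U x < _].
set A := ~: (IN :|: OUT); set L' := fun x => if _ then _ else _.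
set T := top v k _.
have cardT : #|T| = k by rewrite card_top// cardsT card_ord; case/andP: kn.
have INT : IN \subset T.
  apply/fintype.subsetP => x; rewrite inE => Ux; apply/negPn/negP => xT.
  (* By [lt_kth_largest], this irreflexivity says that fewer than [k] items have [U] above [U_(k)];
     the [k] items of [T] will contradict it. *)
  have := ltxx (kth_largest U k); rewrite lt_kth_largest// => /negP; apply.
  rewrite -[X in (X <= _)%N]cardT; apply/subset_leq_card/fintype.subsetP => y yT.
  rewrite inE (lt_le_trans Ux)//; have [Lvx _] := andP (LvU x).
  have [_ vUy] := andP (LvU y); apply: le_trans Lvx (le_trans _ vUy).
  exact/ranked_before_ge/(top_before _ _ _ _ _ _ _ yT (finset.in_setT x) xT).
have OUTT : [disjoint T & OUT].
  apply/fintype.pred0P => x; apply/negP => /= /andP[xT]; rewrite inE => Lx.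
  have := lexx (kth_largest L k); rewrite le_kth_largest//.
  set B := [set y | _]; rewrite -[X in (X <= _)%N]cardT => TB.
  have xB : x \notin B.
    rewrite inE -ltNge; apply: le_lt_trans Lx.
    by have /andP[] := LvU x; exact: le_trans.
  (* [B] has at least [#|T|] elements, so [B \subset T] would force [B = T], although [x] is in [T]
     and not in [B]. *)
  have /subsetPn[y yB yT] : ~~ (B \subset T).
    apply/negP => BT; case/negP: xB; suff -> : B = T by [].
    by apply/eqP; rewrite eqEcard BT.
  move: yB; rewrite inE => /(lt_le_trans Lx); rewrite ltNge => /negP; apply.
  have [Lvy _] := andP (LvU y); have [_ vUx] := andP (LvU x).
  apply: le_trans Lvy (le_trans _ vUx).
  exact/ranked_before_ge/(top_before _ _ _ _ _ _ _ xT (finset.in_setT y) yT).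
have TE : T = IN :|: (T :&: A).
  apply/setP => x; rewrite finset.in_setU finset.in_setI finset.in_setC finset.in_setU negb_or.
  have := fintype.subsetP INT x; case: (x \in IN) => [->//|_] /=.
  by case: (boolP (x \in T)) => //= /(disjointFr OUTT) ->.
(* [IN] is a part of [T], so the natural subtraction does not truncate and gives the exact number of
   top items left in [A]. *)
have cardTA : (k - #|IN| = #|T :&: A|)%N.
  rewrite -cardT {1}TE cardsU (_ : IN :&: (T :&: A) = finset.set0).
    by rewrite cards0 subn0 addKn.
  apply/setP => x; rewrite finset.in_set0 !finset.in_setI finset.in_setC.
  by rewrite finset.in_setU; case: (x \in IN); rewrite ?andbF.
have L'E x : x \in A -> L' x = v x by rewrite /L' mem_enum => ->.
rewrite cardTA top_unique -?TE ?subsetIr// => x y.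
rewrite inE => /andP[xT xA] yA; rewrite inE yA andbT => yT.
rewrite /ranked_before !L'E//; exact: top_before xT (finset.in_setT y) yT.
Qed.

Lemma size_STC_queries (R : realType) (n k : nat) (v L U strong : 'I_n -> R) :
  (0 < k <= n)%N -> (forall x, L x <= v x <= U x) ->
  (size (strong_queries (STC k L U strong)) <=
     near_tie_mass v k (4 * max_radius L U))%N.
Proof.
move=> kn LvU; rewrite /STC /= -cardE /near_tie_mass.
set e := max_radius L U; have eP x := max_radius_ge _ _ L U x.
have Uv : kth_largest U k <= kth_largest v k + 2 * e.
  by apply: kth_largest_leD => // x; have := eP x; have := LvU x; rewrite -/e; lra.
have vL : kth_largest v k <= kth_largest L k + 2 * e.
  by apply: kth_largest_leD => // x; have := eP x; have := LvU x; rewrite -/e; lra.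
apply/subset_leq_card/fintype.subsetP => x.
(* The constant 4: [v x <= L x + 2e <= U_(k) + 2e <= t + 4e], and symmetrically
   [v x >= U x - 2e >= L_(k) - 2e >= t - 4e]. *)
rewrite !inE negb_or -!leNgt => /andP[LU UL]; rewrite ler_norml.
by have := eP x; have := LvU x; rewrite -/e => /andP[? ?] ?; apply/andP; split; lra.
Qed.

(** * Integration and measurability *)

(* The integral of a nonnegative function is a supremum over the simple
   functions below it, so neither f nor g has to be measurable; the number of
   strong calls is never shown to be. *)
Lemma integral_ge0_le (d : measure_display) (T : measurableType d)
    (R : realType) (mu : {measure set T -> \bar R}) (f g : T -> \bar R) :
  (forall x, 0 <= f x)%E -> (forall x, f x <= g x)%E ->
  (\int[mu]_x f x <= \int[mu]_x g x)%E.
Proof.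
move=> f0 fg; have g0 x : (0 <= g x)%E by exact: le_trans (fg x).
rewrite !ge0_integralE// !patch_setT.
apply: ereal_sup_le => _ [h hf <-]; exists h => // x.
exact: le_trans (hf x) (fg x).
Qed.

Lemma measurable_bigmaxr (d : measure_display) (T : measurableType d)
    (R : realType) (I : Type) (s : seq I) (x0 : R) (f : I -> T -> R) :
  (forall i, measurable_fun setT (f i)) ->
  measurable_fun setT (fun w => \big[Num.max/x0]_(i <- s) f i w).
Proof.
move=> mf; elim: s => [|i s ih].
  by under eq_fun do rewrite big_nil; exact: measurable_cst.
by under eq_fun do rewrite big_cons; exact: (measurable_maxr (mf i) ih).
Qed.

(** The cardinality of a random finite set is the sum of the indicators of the events
    [i \in S w]. *)
Lemma measurable_card_set (d : measure_display) (T : measurableType d)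
    (R : realType) (I : finType) (S : T -> {set I}) :
  (forall i, measurable [set w | i \in S w]%classic) ->
  measurable_fun setT (fun w => #|S w|%:R : R).
Proof.
move=> mS; rewrite (_ : (fun w => _) =
    fun w => \sum_(i : I) \1_[set w | i \in S w]%classic w); last first.
  apply/funext => w; rewrite cardE -sum1_size big_enum natr_sum big_mkcond /=.
  apply: eq_bigr => i _; rewrite indicE.
  by case: ifPn => iS; [rewrite mem_set|rewrite memNset//; exact/negP].
by apply: measurable_sum => i; exact: measurable_indic.
Qed.

Lemma probability_bigsetU_le (d : measure_display) (T : measurableType d)
    (R : realType) (mu : {measure set T -> \bar R}) (I : Type) (s : seq I)
    (F : I -> set T) : (forall i, measurable (F i)) ->
  (mu (\big[setU/set0]_(i <- s) F i) <= \sum_(i <- s) mu (F i))%E.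
Proof.
move=> mF; elim: s => [|i s ih]; first by rewrite !big_nil measure0.
rewrite !big_cons; apply: le_trans (leeD2l _ ih); apply: measureU2 => //.
exact: bigsetU_measurable.
Qed.

Lemma measurable_eps_max (d : measure_display) (T : measurableType d)
    (R : realType) (P : probability T R) (n N : nat)
    (W : 'I_n -> nat -> {RV P >-> R}) (r : 'I_n -> {RV P >-> R}) :
  measurable_fun setT (eps_max W N r).
Proof.
rewrite /eps_max /max_radius; apply: measurable_bigmaxr => x.
(* The sample mean cancels in the difference of the two endpoints. *)
rewrite (_ : (fun w => _) = r x); first exact: measurable_funPT.
by apply/funext => w; rewrite /weak_upper /weak_lower; lra.
Qed.

Lemma measurable_near_tie_mass (d : measure_display) (T : measurableType d)
    (R : realType) (n k : nat) (v : 'I_n -> R) (g : T -> R) :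
  measurable_fun setT g ->
  measurable_fun setT (fun w => (near_tie_mass v k (g w))%:R : R).
Proof.
move=> mg; apply: measurable_card_set => x.
rewrite (_ : [set w | _]%classic =
    [set w | `|v x - kth_largest v k| <= g w]%classic); last first.
  by apply/funext => w /=; rewrite inE.
rewrite -[X in measurable X]setTI.
by apply: measurable_fun_le.
Qed.

(** * The coverage event and its failure probability *)

(** De Morgan over the items; the finite union form serves both the union bound and the
    measurability of the failure event. *)
Lemma setC_coverage_event (d : measure_display) (T : measurableType d)
    (R : realType) (P : probability T R) (n N : nat)
    (W : 'I_n -> nat -> {RV P >-> R}) (r : 'I_n -> {RV P >-> R})
    (v : 'I_n -> R) :
  (~` coverage_event W N r v =
   \big[setU/set0]_(x < n)
     ~` [set w | `|sample_mean W N x w - v x| <= r x w])%classic.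
Proof.
rewrite -bigcup_seq -setC_bigcap; congr (~` _)%classic.
rewrite /coverage_event; apply/seteqP; split => w Ew x /= => [_|_].
  by have := Ew x I; rewrite /= /weak_lower /weak_upper ler_norml; lra.
have /= := Ew x; rewrite mem_index_enum /weak_lower /weak_upper ler_norml.
by move=> /(_ isT); lra.
Qed.

Lemma measurable_sample_mean_dev (d : measure_display) (T : measurableType d)
    (R : realType) (P : probability T R) (n N : nat)
    (W : 'I_n -> nat -> {RV P >-> R}) (r : 'I_n -> {RV P >-> R})
    (v : 'I_n -> R) (x : 'I_n) :
  measurable [set w | `|sample_mean W N x w - v x| <= r x w]%classic.
Proof.
rewrite -[X in measurable X]setTI; apply: measurable_fun_le => //.
apply: measurableT_comp => //; apply: measurable_funB => //.
by apply: measurable_funM => //; apply: measurable_sum.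
Qed.

Lemma probability_setC_coverage_event_le (d : measure_display) (T : measurableType d)
    (R : realType) (P : probability T R) (n N : nat)
    (W : 'I_n -> nat -> {RV P >-> R}) (r : 'I_n -> {RV P >-> R})
    (v dlt : 'I_n -> R) : valid_half_widths W N r v dlt ->
  (P (~` coverage_event W N r v)%classic <= (\sum_(x < n) dlt x)%:E)%E.
Proof.
move=> hr; rewrite setC_coverage_event.
have mF x := measurable_sample_mean_dev _ _ _ P _ N W r v x.
apply: le_trans (probability_bigsetU_le _ _ _ P _ _ _ _) _ => [x|].
  exact: measurableC.
rewrite -sumEFin; apply: lee_sum => x _.
rewrite [X in (X <= _)%E](probability_setC P (mF x)).
have [_] := hr x; set q := P _ => dq.
have : q \is a fin_num by apply: fin_num_measure.
move: dq; case: q => // q; rewrite -EFinB !lee_fin; lra.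
Qed.

(** The two last conjuncts make the bound in expectation precise: one restricts both sides to [E],
    the other charges the failure event [n] calls, the most that any run can make. *)
Theorem theorem2 (R : realType) (d : measure_display) (T : measurableType d)
    (P : probability T R)
    (n k : nat) (hk : (1 <= k <= n)%N)
    (v : 'I_n -> R) (hv : forall x, 0 <= v x <= 1)
    (W : 'I_n -> nat -> {RV P >-> R}) (hW : weak_oracle v W)
    (strong : 'I_n -> R) (hS : forall x, strong x = v x)
    (N : nat) (hN : (0 < N)%N)
    (delta : R) (dlt : 'I_n -> R) (hdelta : \sum_(x < n) dlt x <= delta)
    (r : 'I_n -> {RV P >-> R}) (hr : valid_half_widths W N r v dlt) :
  let E := coverage_event W N r v in
  let calls := strong_calls W N r k strong in
  let mass := fun w => near_tie_mass v k (4 * eps_max W N r w) in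
  (forall w, E w ->
     stc_output (stc_run W N r k strong w) = top v k [set: 'I_n]%SET /\
     (calls w <= mass w)%N) /\
  (P (~` E)%classic <= delta%:E)%E /\
  ('E_P[fun w => ((calls w)%:R * \1_E w)%R] <=
     'E_P[fun w => ((mass w)%:R * \1_E w)%R])%E /\
  ('E_P[fun w => (calls w)%:R%R] <=
     'E_P[fun w => (mass w)%:R%R] + (n%:R * delta)%R%:E)%E.
Proof.
move=> E calls mass.
have Ecov w : E w ->
    forall x, weak_lower W N r w x <= v x <= weak_upper W N r w x.
  by move=> Ew x; exact: (Ew x I).
have callsE w : E w -> (calls w <= mass w)%N.
  by move=> Ew; apply: size_STC_queries => //; exact: Ecov.
have PE : (P (~` E)%classic <= delta%:E)%E.
  have := probability_setC_coverage_event_le _ _ _ _ _ _ _ _ _ _ hr.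
  by move=> /le_trans; apply; rewrite lee_fin.
have mEC : measurable (~` E)%classic.
  rewrite /E setC_coverage_event; apply: bigsetU_measurable => x _.
  exact/measurableC/measurable_sample_mean_dev.
split.
  move=> w Ew; split; last exact: callsE.
  by apply: STC_output_top => //; exact: Ecov.
split=> //; split.
  rewrite unlock; apply: integral_ge0_le => w; rewrite lee_fin ?mulr_ge0//.
  rewrite indicE; case: (asboolP (E w)) => [Ew|nEw].
    by rewrite mem_set// !mulr1 ler_nat callsE.
  by rewrite memNset// !mulr0.
(* Measurability is for the additivity of the integral, used below to split off the failure term. *)
have mmass : measurable_fun setT (fun w => (mass w)%:R : R).
  apply: measurable_near_tie_mass; apply: measurable_funM => //.
  exact: measurable_eps_max.
have m1 : measurable_fun setT (\1_(~` E)%classic : T -> R).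
  exact: measurable_indic.
(* The pointwise bound behind this is [calls w <= mass w + n * \1_(~] E) w[; writing]P (~[E)] as the
   integral of an indicator merges the right side into one integral. *)
apply: (@le_trans _ _
    ('E_P[fun w => (mass w)%:R%R] + n%:R%:E * P (~` E)%classic)%E);
  last by rewrite leeD2l// EFinM lee_wpmul2l.
rewrite unlock -[X in P X]setIT -(integral_indic P measurableT mEC).
rewrite -ge0_integralZl_EFin//; last exact/measurable_EFinP.
rewrite -ge0_integralD//; last 2 first.
- exact/measurable_EFinP.
- by apply/measurable_EFinP; exact: measurable_funM.
apply: integral_ge0_le => w; first by rewrite lee_fin.
rewrite -EFinM -EFinD lee_fin indicE; case: (asboolP (E w)) => [Ew|nEw].
  by rewrite memNset ?mulr0 ?addr0 ?ler_nat ?callsE//= => /(_ Ew).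
rewrite mem_set// mulr1 -natrD ler_nat.
apply: leq_trans (leq_addl _ _).
rewrite /calls /strong_calls /stc_run /STC /= -cardE.
by rewrite -[X in (_ <= X)%N]card_ord max_card.
Qed.
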